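(* For all integers $r\geq 2$ and $n\geq 1$, the complete balanced $r$-partite graph $K_{n,\ldots,n}$ (with $r$ parts, each having exactly $n$ vertices) is interval total colorable.
   Context: All graphs are finite, undirected, without loops or multiple edges. The complete balanced $r$-partite graph $K_{n,\ldots,n}$ has vertex set partitioned into $r$ independent sets $V_1,\ldots,V_r$ with $|V_i|=n$ for all $i$, and every vertex of $V_i$ is adjacent to every vertex of $V_j$ whenever $i\neq j$. A total coloring of a graph $G$ is a coloring of its vertices and edges such that no two adjacent vertices, no two adjacent edges, and no vertex and edge incident to each other get the same color. For a total coloring $\alpha$ and a vertex $v$, $S[v,\alpha]$ denotes the set consisting of $\alpha(v)$ and the colors of all edges incident to $v$. For a positive integer $t$, an interval total $t$-coloring of $G$ is a total coloring $\alpha$ of $G$ with colors $1,\ldots,t$ such that all $t$ colors are used (each on at least one vertex or edge), and for every vertex $v$ the set $S[v,\alpha]$ is an interval of integers (a set of consecutive integers). $G$ is interval total colorable if it has an interval total $t$-coloring for some positive integer $t$. *)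

(* Defs.v *)
From mathcomp Require Import all_boot.

Set Implicit Arguments.
Unset Strict Implicit.
Unset Printing Implicit Defensive.

Record simple_graph := SimpleGraph {
  vertex : finType;
  adj : rel vertex;
  adj_sym : symmetric adj;
  adj_irrefl : irreflexive adj
}.

Definition edges (G : simple_graph) : {set {set vertex G}} :=
  [set [set p.1; p.2] | p : vertex G * vertex G & adj p.1 p.2].

(* A coloring gives [alpha (inl v)] to the vertex [v] and [alpha (inr e)] to the
   edge [e]; its values at sets [e] that are not edges are never consulted. *)
Definition coloring (G : simple_graph) : Type :=
  (vertex G + {set vertex G} -> nat)%type.

Definition total_coloring (G : simple_graph) (alpha : coloring G) : Prop :=
  [/\ forall u v : vertex G, adj u v -> alpha (inl u) <> alpha (inl v),
      forall e f : {set vertex G}, e \in edges G -> f \in edges G ->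
        e <> f -> (exists v, v \in e /\ v \in f) ->
        alpha (inr e) <> alpha (inr f)
    & forall (v : vertex G) (e : {set vertex G}), e \in edges G -> v \in e ->
        alpha (inl v) <> alpha (inr e)].

(* The set S[v, alpha], as the sequence of its elements. *)
Definition spectrum (G : simple_graph) (alpha : coloring G) (v : vertex G) :
    seq nat :=
  alpha (inl v) :: [seq alpha (inr e) | e in [set f in edges G | v \in f]].

Definition nat_interval (s : seq nat) : Prop :=
  forall a b c : nat, a \in s -> b \in s -> a <= c <= b -> c \in s.

Definition interval_total_coloring (G : simple_graph) (t : nat)
    (alpha : coloring G) : Prop :=
  [/\ total_coloring alpha,
      (forall v : vertex G, 1 <= alpha (inl v) <= t) /\
      (forall e : {set vertex G}, e \in edges G -> 1 <= alpha (inr e) <= t),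
      forall c : nat, 1 <= c <= t ->
        (exists v : vertex G, alpha (inl v) = c) \/
        (exists e : {set vertex G}, e \in edges G /\ alpha (inr e) = c)
    & forall v : vertex G, nat_interval (spectrum alpha v)].

Definition interval_total_colorable (G : simple_graph) : Prop :=
  exists t : nat, 0 < t /\ exists alpha : coloring G,
    interval_total_coloring t alpha.

(* The [i]-th part of the complete balanced [r]-partite graph is
   {(i, j) | j : 'I_n}. *)
Definition multipartite_adj (r n : nat) : rel ('I_r * 'I_n) :=
  fun x y => x.1 != y.1.

Lemma multipartite_adj_sym (r n : nat) : symmetric (@multipartite_adj r n).
Proof. by move=> x y; rewrite /multipartite_adj eq_sym. Qed.

Lemma multipartite_adj_irrefl (r n : nat) :
  irreflexive (@multipartite_adj r n).
Proof. by move=> x; rewrite /multipartite_adj eqxx. Qed.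

Definition complete_balanced_multipartite (r n : nat) : simple_graph :=
  SimpleGraph (@multipartite_adj_sym r n) (@multipartite_adj_irrefl r n).

(* Main.v *)
(* In a d-regular graph, a total coloring whose colors at each vertex lie in a
   window of d + 1 integers has interval spectra, so only properness and window
   bounds matter.

   For r = 2k parts, take the edge coloring of K_2k obtained from the round-robin
   1-factorization in which the colors at a vertex form the interval
   [l, l + 2k - 2], where each level l < k belongs to exactly two vertices.
   Replace each vertex by n vertices and each color by n colors; at each level,
   one part gets the color just below its edge colors and the other the color
   just above.

   For n even, cut the parts into halves and do the same with K_2r, whose color
   class r - 1 is chosen to be the matching between the halves of each part;
   it is deleted, and the later colors are shifted down by one.

   For r and n odd, give a last part P a single color M = (r - 1)n and identify
   the other vertices with Z/M, the parts being the classes modulo r - 1.  The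
   pairs at distance M/2 get the color M too (they are edges because n is odd),
   and the other colors are the translates of a starter of Z/M: its pairs at
   distances divisible by r - 1 are dropped, and their n - 1 endpoints together
   with its two unpaired points serve for the edges to P and the vertex colors.
   All d + 1 colors then occur at every vertex. *)
Require Import Defs.
From mathcomp Require Import all_boot.
From mathcomp Require Import zify.

Set Implicit Arguments.
Unset Strict Implicit.
Unset Printing Implicit Defensive.

Lemma eq_set2 (T : finType) (a b c d : T) :
  [set a; b] = [set c; d] -> (a = c /\ b = d) \/ (a = d /\ b = c).
Proof.
move=> E.
have := in_set2 a c d; rewrite -E set21 => /esym/orP.
have := in_set2 b c d; rewrite -E set22 => /esym/orP.
have := in_set2 c a b; rewrite E set21 => /esym/orP.
have := in_set2 d a b; rewrite E set22 => /esym/orP.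
by do 4![case=> /eqP ?]; subst; auto.
Qed.

(** * Window colorings of regular graphs *)

Section Window.

Variables (G : simple_graph) (d : nat).
Variables (a lo : vertex G -> nat) (c : vertex G -> vertex G -> nat).

(** [pick] may choose either orientation of the edge, harmless once [c] is symmetric; the successors
    make colors start at 1. *)
Definition pair_coloring : coloring G := fun s =>
  match s with
  | inl v => (a v).+1
  | inr e =>
    if [pick p : vertex G * vertex G | adj p.1 p.2 && (e == [set p.1; p.2])]
      is Some p then (c p.1 p.2).+1 else 0
  end.

Hypothesis c_sym : forall x y, adj x y -> c x y = c y x.

Lemma pair_coloring_edge x y :
  adj x y -> pair_coloring (inr [set x; y]) = (c x y).+1.
Proof.
move=> xy; rewrite /pair_coloring; case: pickP => [[u v] /=|/(_ (x, y))].
  by case/andP=> _ /eqP /eq_set2 [] [<- <-]; rewrite ?(c_sym xy).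
by rewrite /= xy eqxx.
Qed.

Lemma edgesP (e : {set vertex G}) :
  reflect (exists x y, adj x y /\ e = [set x; y]) (e \in edges G).
Proof.
apply: (iffP imsetP) => [[[x y] /= h ->]|[x [y [h ->]]]].
  by exists x, y; rewrite inE in h.
by exists (x, y); rewrite ?inE.
Qed.

Lemma edges_memP (e : {set vertex G}) x :
  e \in edges G -> x \in e -> exists2 y, adj x y & e = [set x; y].
Proof.
case/edgesP=> u [v [uv ->]] /set2P [->|->]; first by exists v.
by exists u; rewrite 1?adj_sym // setUC.
Qed.

Hypothesis regular : forall x : vertex G, #|[pred y | adj x y]| = d.
Hypothesis a_proper : forall x y, adj x y -> a x <> a y.
Hypothesis ac_proper : forall x y, adj x y -> a x <> c x y.
Hypothesis c_proper :
  forall x y z, adj x y -> adj x z -> c x y = c x z -> y = z.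
Hypothesis a_window : forall x, lo x <= a x <= lo x + d.
Hypothesis c_window : forall x y, adj x y -> lo x <= c x y <= lo x + d.

(** The [d + 1] colors at [x] are distinct, so they exhaust a window of [d + 1] integers. *)
Lemma window_full x k :
  lo x <= k <= lo x + d -> k = a x \/ exists2 y, adj x y & k = c x y.
Proof.
move=> hk; pose s := a x :: [seq c x y | y in [pred y | adj x y]].
have us : uniq s.
  rewrite /= map_inj_in_uniq ?enum_uniq ?andbT.
    by apply/mapP=> -[y]; rewrite mem_enum inE => /ac_proper.
  by move=> y z; rewrite !mem_enum !inE; apply: c_proper.
have ss : {subset s <= iota (lo x) d.+1}.
  move=> j; rewrite mem_iota inE => /orP[/eqP->|/mapP[y]].
    by have := a_window x; lia.
  by rewrite mem_enum inE => /c_window h ->; lia.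
have [|_ /(_ k)] := uniq_min_size us ss.
  by rewrite size_iota /= size_map -cardE regular.
rewrite mem_iota addnS ltnS hk inE => /orP[/eqP->|/mapP[y]]; first by left.
by rewrite mem_enum inE => h ->; right; exists y.
Qed.

Hypothesis lo_bound : forall x, lo x <= d.+1.

(* As [lo <= d + 1], the window of a vertex with largest [lo] meets or continues
   the window of [x0], so no color is skipped. *)
Lemma window_colorable x0 : lo x0 = 0 -> interval_total_colorable G.
Proof.
move=> lo0; have [xm hm] : exists xm, forall x, lo x <= lo xm.
  by exists [arg max_(x > x0) lo x]; case: arg_maxnP => // i _ h x; apply: h.
exists (lo xm + d).+1; split=> //; exists pair_coloring; split.
- split=> [u v uv [] /(a_proper uv) //| e f he hf ef [v [ve vf]] | v e he ve].
    have [x vx Ee] := edges_memP he ve; have [y vy Ef] := edges_memP hf vf.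
    rewrite Ee Ef !pair_coloring_edge // => -[] /(c_proper vx vy) xy.
    by apply: ef; rewrite Ee Ef xy.
  have [x vx ->] := edges_memP he ve.
  by rewrite pair_coloring_edge // => -[] /(ac_proper vx).
- split=> [v|e /edgesP[x [y [xy ->]]]].
    by have := a_window v; have := hm v; rewrite /=; lia.
  by rewrite pair_coloring_edge //; have := c_window xy; have := hm x; lia.
- move=> k hk.
  have [x hx] : exists x, lo x <= k.-1 <= lo x + d.
    case: (leqP k.-1 d) => h; first by exists x0; rewrite lo0.
    by exists xm; have := lo_bound xm; lia.
  have [ka|[y xy kc]] := window_full hx; [left; exists x|right].
    by rewrite /= -ka; lia.
  exists [set x; y]; split; first by apply/edgesP; exists x, y.
  by rewrite pair_coloring_edge // -kc; lia.
- move=> x i j k.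
  have sub l : l \in spectrum pair_coloring x -> lo x < l <= (lo x + d).+1.
    rewrite inE => /orP[/eqP->|/mapP[e]]; first exact: a_window.
    rewrite mem_enum !inE => /andP[he xe ->].
    have [y xy ->] := edges_memP he xe.
    by rewrite pair_coloring_edge //; apply: c_window.
  move=> /sub hi /sub hj hk.
  have hk1 : lo x <= k.-1 <= lo x + d by lia.
  rewrite inE; have [ka|[y xy kc]] := window_full hk1; apply/orP.
    by left; apply/eqP; rewrite /= -ka; lia.
  right; apply/mapP; exists [set x; y].
    by rewrite mem_enum !inE eqxx andbT; apply/edgesP; exists x, y.
  by rewrite pair_coloring_edge // -kc; lia.
Qed.

End Window.

Lemma card_multipartite_adj r n (x : 'I_r * 'I_n) :
  #|[pred y | @multipartite_adj r n x y]| = r.-1 * n.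
Proof.
have -> : r.-1 * n = #|setX [set~ x.1] [set: 'I_n]|.
  by rewrite cardsX cardsC1 cardsT !card_ord.
by apply: eq_card => y; rewrite !inE andbT eq_sym.
Qed.

(** * Blow-ups of edge colorings *)

Section BlowUp.

Variables (G : simple_graph) (m D : nat).
Variables (b s lev : vertex G -> nat) (high : pred (vertex G)).
Variable F : vertex G -> vertex G -> nat.

(* The [m * m] edges between two blocks that share the value [F] of the quotient
   edge are colored by the addition table of Z/m. *)
Lemma blowup_colorable x0 :
    0 < m -> (forall x, s x < m) ->
    (forall x y, b x = b y -> s x = s y -> x = y) ->
    (forall x y, F x y = F y x) ->
    (forall x y z, adj x y -> adj x z -> F x y = F x z -> b y = b z) ->
    (forall x y, adj x y -> lev x <= F x y < lev x + D) ->
    (forall x : vertex G, #|[pred y | adj x y]| = D * m) ->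
    (forall x y, adj x y -> high x = high y -> lev x <> lev y) ->
    (forall x, lev x <= D) -> lev x0 = 0 -> ~~ high x0 ->
  interval_total_colorable G.
Proof.
move=> m0 sm bs_inj F_sym F_proper F_window reg lev_proper lev_bound l0 h0.
have lm x : lev x * m <= D * m by rewrite leq_mul2r lev_bound orbT.
have addm x y z : s y = s z \/ (s x + s y) %% m <> (s x + s z) %% m.
  case: (eqVneq ((s x + s y) %% m) ((s x + s z) %% m)) => [/eqP|/eqP]; last by right.
  by rewrite eqn_modDl !(modn_small (sm _)) => /eqP; left.
have Fm x y : adj x y -> lev x * m <= F x y * m /\ F x y * m + m <= lev x * m + D * m.
  move=> /F_window /andP[h1 h2]; rewrite addnC -mulSn -mulnDl.
  by rewrite !leq_mul2r h1 h2 !orbT.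
pose c x y := F x y * m + ((s x + s y) %% m).+1.
pose a x := if high x then lev x * m + (D * m).+1 else lev x * m.
apply: (@window_colorable G (D * m) a (fun x => lev x * m + high x) c
  _ _ _ _ _ _ _ _ x0) => //.
- by move=> x y _; rewrite /c F_sym (addnC (s x)).
- move=> x y xy; rewrite /a; have := lev_proper _ _ xy.
  have := lm x; have := lm y.
  (* Levels are at most [D], so low vertex colors never exceed [D * m], while high ones do. *)
  case: (high x) (high y) => [] [] hx hy H E; try lia.
    by apply: (H erefl); apply/eqP; rewrite -(eqn_pmul2r m0); apply/eqP; lia.
  by apply: (H erefl); apply/eqP; rewrite -(eqn_pmul2r m0) E.
- move=> x y xy; rewrite /a /c; have [] := Fm _ _ xy.
  by have := ltn_pmod (s x + s y) m0; case: (high x); lia.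
- move=> x y z xy xz; rewrite /c !addnS => -[] E.
  have EF : F x y = F x z.
    have := congr1 (divn^~ m) E.
    by rewrite /= !divnMDl // !(divn_small (ltn_pmod _ m0)) !addn0.
  have Es : (s x + s y) %% m = (s x + s z) %% m.
    by apply/eqP; rewrite -(eqn_add2l (F x y * m)) E EF.
  by case: (addm x y z) => // ?; apply: bs_inj => //; apply: F_proper xy xz EF.
- by move=> x; rewrite /a; case: (high x); lia.
- move=> x y xy; rewrite /c; have [] := Fm _ _ xy.
  by have := ltn_pmod (s x + s y) m0; case: (high x); lia.
- by move=> x; have := lm x; case: (high x); lia.
- by rewrite l0 (negbTE h0).
Qed.

End BlowUp.

(** * Round-robin colorings and an even number of parts *)

(* For [x, y < 2k - 1] this halves [x + y] modulo [2k - 1]; the vertex [2k - 1]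
   plays the role of the point at infinity of the round-robin tournament. *)
Definition rr_color k x y :=
  if x == k.*2.-1 then y else if y == k.*2.-1 then x
  else if odd (x + y) then (x + y + k.*2.-1)./2 else (x + y)./2.

Definition rr_level k x := if x == k.*2.-1 then 0 else uphalf x.

Lemma rr_color_sym k x y : x < k.*2 -> y < k.*2 -> rr_color k x y = rr_color k y x.
Proof. by rewrite /rr_color; repeat case: ifP; lia. Qed.

Lemma rr_color_proper k x y z : x < k.*2 -> y < k.*2 -> z < k.*2 ->
  x != y -> x != z -> rr_color k x y = rr_color k x z -> y = z.
Proof. by rewrite /rr_color; repeat case: ifP; lia. Qed.

(** For finite [x], halves of even sums come first and unreduced halves of odd sums continue them;
    infinity takes the color [x] missing at [y = x]. *)
Lemma rr_color_window k x y : x < k.*2 -> y < k.*2 -> x != y ->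
  rr_level k x <= rr_color k x y < rr_level k x + k.*2.-1.
Proof. by rewrite /rr_color /rr_level; repeat case: ifP; lia. Qed.

Lemma rr_level_bound k x : x < k.*2 -> rr_level k x <= k.-1.
Proof. by rewrite /rr_level; repeat case: ifP; lia. Qed.

(** Level [l > 0] is shared by [2l - 1] and [2l], level 0 by 0 and infinity, the odd [2k - 1]. *)
Lemma rr_level_proper k x y : x < k.*2 -> y < k.*2 ->
  odd x = odd y -> rr_level k x = rr_level k y -> x = y.
Proof. by rewrite /rr_level; repeat case: ifP; lia. Qed.

Lemma multipartite_even_parts k n : 0 < k -> 0 < n ->
  interval_total_colorable (complete_balanced_multipartite k.*2 n).
Proof.
move=> k0 n0; set G := complete_balanced_multipartite _ _.
have lt_inf : k.*2.-1 < k.*2 by lia.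
pose x0 : vertex G := (Ordinal lt_inf, Ordinal n0).
pose lev (x : vertex G) := rr_level k x.1.
pose F (x y : vertex G) := rr_color k x.1 y.1.
apply: (@blowup_colorable G n k.*2.-1 (fun x => x.1) (fun x => x.2) lev
  (fun x => ~~ odd x.1) F x0) => //.
- by case=> [p i] [q j] /= /val_inj -> /val_inj ->.
- by move=> x y; apply: rr_color_sym; apply: ltn_ord.
- by move=> x y z xy xz; apply: rr_color_proper xy xz; apply: ltn_ord.
- by move=> x y xy; apply: rr_color_window xy; apply: ltn_ord.
- by move=> x; rewrite card_multipartite_adj.
- move=> x y /eqP xy /negb_inj ho hl; apply: xy; apply: val_inj.
  by apply: rr_level_proper ho hl; apply: ltn_ord.
- by move=> x; apply: leq_trans (rr_level_bound (ltn_ord x.1)) _; lia.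
- by rewrite /lev /rr_level /= eqxx.
- by rewrite /=; lia.
Qed.

(** * Parts of even size *)

(* Each part is split into two halves, which become vertices [p] and
   [half_partner r p] of K_2r; the pairs of halves are exactly the color class
   [r - 1] of [rr_color], and discarding it leaves intervals. *)
Definition half_partner r p := if p == r.-1 then r.*2.-1 else r.*2.-2 - p.

Definition drop_color r i := if i < r.-1 then i else i.-1.

Definition half_block r m p i := if i < m then p else half_partner r p.

Lemma half_block_lt r m p i : p < r -> half_block r m p i < r.*2.
Proof. by rewrite /half_block /half_partner; repeat case: ifP; lia. Qed.

Lemma half_block_proper r m p q i j : p < r -> q < r -> p != q ->
  half_block r m p i != half_block r m q j.
Proof. by rewrite /half_block /half_partner; repeat case: ifP; lia. Qed.

(** Color [r - 1] joins only points with sum [2r - 2], or [r - 1] with infinity: the two halves of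
    one part. *)
Lemma half_block_color r m p q i j : p < r -> q < r -> p != q ->
  rr_color r (half_block r m p i) (half_block r m q j) != r.-1.
Proof.
by rewrite /half_block /half_partner /rr_color; repeat case: ifP; lia.
Qed.

Lemma half_block_inj r m p q i j : p < r -> q < r ->
    half_block r m p i = half_block r m q j ->
    (if i < m then i else i - m) = (if j < m then j else j - m) ->
  p = q /\ i = j.
Proof. by rewrite /half_block /half_partner; repeat case: ifP; lia. Qed.

Lemma multipartite_even_size r m : 1 < r -> 0 < m ->
  interval_total_colorable (complete_balanced_multipartite r m.*2).
Proof.
move=> r1 m0; set G := complete_balanced_multipartite _ _.
have r1r : r.-1 < r by lia.
have mm : m < m.*2 by lia.
(* Its block is infinity, which has level 0 and an odd label. *)
pose x0 : vertex G := (Ordinal r1r, Ordinal mm).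
pose b (x : vertex G) := half_block r m x.1 x.2.
pose s (x : vertex G) := if x.2 < m then val x.2 else x.2 - m.
have b_lt x : b x < r.*2 by apply: half_block_lt.
have b_adj (x y : vertex G) : adj x y -> b x != b y /\ rr_color r (b x) (b y) != r.-1.
  by move=> xy; split; [apply: half_block_proper | apply: half_block_color].
pose lev (x : vertex G) := rr_level r (b x).
pose F (x y : vertex G) := drop_color r (rr_color r (b x) (b y)).
apply: (@blowup_colorable G m r.*2.-2 b s lev (fun x => ~~ odd (b x)) F x0) => //.
- by case=> p i; have := ltn_ord i; rewrite /s /=; case: ifP; lia.
- move=> [p i] [q j] hb hs.
  have [] := half_block_inj (ltn_ord p) (ltn_ord q) hb hs.
  by move=> /= /val_inj -> /val_inj ->.
- by move=> x y; rewrite /F rr_color_sym.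
- move=> x y z xy xz; have [bxy cxy] := b_adj _ _ xy; have [bxz cxz] := b_adj _ _ xz.
  move=> h; apply: (rr_color_proper _ _ _ bxy bxz) => //.
  by move: h; rewrite /F /drop_color; repeat case: ifP; lia.
- move=> x y xy; have [bxy cxy] := b_adj _ _ xy.
  have := rr_color_window (b_lt x) (b_lt y) bxy.
  (* The level is at most [r - 1], so the dropped color lies in the window and shortens it by
     one. *)
  have := rr_level_bound (b_lt x).
  by rewrite /lev /F /drop_color; repeat case: ifP; lia.
- by move=> x; rewrite card_multipartite_adj; nia.
- move=> x y /b_adj [bxy _] /negb_inj ho hl.
  by move/eqP: bxy; apply; apply: rr_level_proper ho hl.
- by move=> x; have := rr_level_bound (b_lt x); rewrite /lev; lia.
- by rewrite /lev /rr_level /b /half_block /half_partner /= ltnn !eqxx.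
- by rewrite /b /half_block /half_partner /= ltnn eqxx; repeat case: ifP; lia.
Qed.

(** * An odd number of parts of odd size *)

(* Modulo [2K], the pair [x, x + e] with [0 < e < K] receives the color
   [x + (e - 1)/2] if [e] is odd, and the antipode [x + e/2 + K] of its midpoint
   if [e] is even; for [e > K] the formula reads the same color from the other
   endpoint. The values at [0] and [K] are the offsets used by no pair. *)
Definition starter K e := e./2 + (if (e != K) && (odd e == (K < e)) then K else 0).

Definition add_mod M x y := if x + y < M then x + y else x + y - M.

Definition sub_mod M y x := if x <= y then y - x else y + M - x.

Lemma starter_lt K e : e < K.*2 -> starter K e < K.*2.
Proof. by rewrite /starter; repeat case: ifP; lia. Qed.

(** Odd [e < K], then [K], then even [e > K] fill [[0, K)] in order; even [e < K], then odd [e > K]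
    fill [[K, 2K)]. *)
Lemma starter_inj K e f : e < K.*2 -> f < K.*2 ->
  starter K e = starter K f -> e = f.
Proof. by rewrite /starter; repeat case: ifP; lia. Qed.

Lemma sub_mod_lt M x y : x < M -> y < M -> sub_mod M y x < M.
Proof. by rewrite /sub_mod; repeat case: ifP; lia. Qed.

Lemma sub_mod_inj M x y z : x < M -> y < M -> z < M ->
  sub_mod M y x = sub_mod M z x -> y = z.
Proof. by rewrite /sub_mod; repeat case: ifP; lia. Qed.

Lemma add_mod_lt M x y : x < M -> y < M -> add_mod M x y < M.
Proof. by rewrite /add_mod; repeat case: ifP; lia. Qed.

Lemma add_mod_injr M x y z : x < M -> y < M -> z < M ->
  add_mod M x y = add_mod M x z -> y = z.
Proof. by rewrite /add_mod; repeat case: ifP; lia. Qed.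

Lemma add_mod_injl M x y z : x < M -> y < M -> z < M ->
  add_mod M y x = add_mod M z x -> y = z.
Proof. by rewrite /add_mod; repeat case: ifP; lia. Qed.

Lemma starter_sym K x y : x < K.*2 -> y < K.*2 -> x != y ->
  sub_mod K.*2 y x != K ->
  add_mod K.*2 x (starter K (sub_mod K.*2 y x)) =
  add_mod K.*2 y (starter K (sub_mod K.*2 x y)).
Proof. by rewrite /add_mod /starter /sub_mod; repeat case: ifP; lia. Qed.

Lemma sub_mod_half_sym K x y : x < K.*2 -> y < K.*2 ->
  (sub_mod K.*2 y x == K) = (sub_mod K.*2 x y == K).
Proof. by rewrite /sub_mod; repeat case: ifP; lia. Qed.

Lemma multipartite_odd_parts k n : 0 < k -> odd n ->
  interval_total_colorable (complete_balanced_multipartite k.*2.+1 n).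
Proof.
move=> k0 on; set G := complete_balanced_multipartite _ _.
have n0 : 0 < n by case: n on {G}.
pose K := k * n; pose M := K.*2.
have ME : M = k.*2 * n by rewrite /M /K doubleMl.
have K0 : 0 < K by rewrite muln_gt0 k0.
have mulK i : k.*2 * i != K.
  rewrite /K -muln2 -mulnA eqn_pmul2l // mul2n.
  by apply: contraTneq on => <-; rewrite odd_double.
pose h (x : vertex G) := x.1 + k.*2 * x.2.
pose inner (x : vertex G) := x.1 < k.*2.
have h_lt x : inner x -> h x < M.
  move=> hx; rewrite ME; apply: (@leq_trans (k.*2 * x.2.+1)).
    by rewrite mulnS ltn_add2r.
  by rewrite leq_pmul2l ?double_gt0.
have h_mod x : inner x -> h x = x.1 %[mod k.*2] by rewrite /h addnC mulnC modnMDl.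
have h_inj x y : inner x -> inner y -> h x = h y -> x = y.
  case: x y => [p i] [q j] hp hq E.
  have pq : val p = val q.
    by have := congr1 (modn^~ k.*2) E; rewrite /= !h_mod // !modn_small.
  move: E; rewrite /h /= pq => /addnI /eqP.
  by rewrite eqn_pmul2l ?double_gt0 // (val_inj pq) => /eqP /val_inj ->.
(* An edge to the last part borrows a distance divisible by [2k], which no edge between inner
   vertices has. *)
pose dist (x y : vertex G) := if inner y then sub_mod M (h y) (h x) else k.*2 * y.2.
have mul_lt (i : 'I_n) : k.*2 * i < M.
  by rewrite ME ltn_pmul2l ?double_gt0.
have dist_lt x y : inner x -> dist x y < M.
  by move=> hx; rewrite /dist; case: ifP => // hy; apply: sub_mod_lt; apply: h_lt.
have outer x : ~~ inner x -> val x.1 = k.*2.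
  by rewrite /inner -leqNgt => hx; apply/eqP; rewrite eqn_leq hx -ltnS ltn_ord.
have dist_mod x y : inner x -> adj x y -> (k.*2 %| dist x y) = ~~ inner y.
  move=> hx xy; rewrite /dist; case: ifPn => hy; last exact: dvdn_mulr.
  apply: contraNF xy => hd; apply/eqP/val_inj.
  suff : h x = h y %[mod k.*2] by rewrite !h_mod // !modn_small.
  have [q hq] : exists q, h x + sub_mod M (h y) (h x) = h y + q * k.*2.
    have := h_lt _ hx; have := h_lt _ hy; rewrite /sub_mod; case: (leqP (h x)) => h1 h2 h3.
      by exists 0; lia.
    by exists n; rewrite mulnC -ME; lia.
  by rewrite -(modnMDl q (h y)) [q * _ + _]addnC -hq -modnDmr (eqP hd) addn0.
have dist_inj x y z : inner x -> adj x y -> adj x z -> dist x y = dist x z -> y = z.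
  move=> hx xy xz E.
  have : ~~ inner y = ~~ inner z by rewrite -(dist_mod x) // E dist_mod.
  move/negb_inj; move: E; rewrite /dist; case: ifPn => hy; case: ifPn => hz // E _.
    by apply: h_inj => //; apply: sub_mod_inj E; apply: h_lt.
  case: y z hy hz E {xy xz} => [p i] [q j] /outer hp /outer hq /eqP.
  rewrite eqn_pmul2l ?double_gt0 //= => /eqP /val_inj ->.
  by congr (_, _); apply: val_inj; rewrite -[LHS]/(val p) hp hq.
pose c0 x y := if dist x y == K then M else add_mod M (h x) (starter K (dist x y)).
pose c x y := if inner x then c0 x y else c0 y x.
(* Distance [K] has the color [M], which leaves the offset [starter K K] for the vertex itself. *)
pose a x := if inner x then add_mod M (h x) (starter K K) else M.
have a_outer x : ~~ inner x -> a x = M by rewrite /a => /negbTE ->.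
have KM : K < M by rewrite /M; lia.
have a_lt x : inner x -> a x < M.
  by move=> hx; rewrite /a hx; apply: add_mod_lt; rewrite ?h_lt ?starter_lt.
have c0_le x y : inner x -> c0 x y <= M.
  move=> hx; rewrite /c0; case: ifP => // _.
  by apply/ltnW/add_mod_lt; rewrite ?h_lt ?starter_lt ?dist_lt.
have c0_outer x y : ~~ inner y -> c0 x y = add_mod M (h x) (starter K (k.*2 * y.2)).
  by move=> hy; rewrite /c0 /dist (negbTE hy) (negbTE (mulK _)).
have c0_outer_lt x y : inner x -> ~~ inner y -> c0 x y < M.
  by move=> hx hy; rewrite c0_outer // add_mod_lt ?h_lt ?starter_lt.
have adj_inner x y : adj x y -> ~~ inner x -> inner y.
  move=> xy /outer hx; apply: contraNT xy => /outer hy.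
  by apply/eqP/val_inj; rewrite hx hy.
have c_le x y : adj x y -> c x y <= M.
  move=> xy; rewrite /c; case: ifPn => hx; apply: c0_le => //.
  exact: adj_inner xy hx.
apply: (@window_colorable G M a (fun=> 0) c _ _ _ _ _ _ _ _ (ord0, Ordinal n0)) => //.
- move=> x y xy; rewrite /c; case: ifPn => hx; case: ifPn => hy //; last first.
    by rewrite (adj_inner x) in hy.
  rewrite /c0 /dist hx hy sub_mod_half_sym ?h_lt //.
  case: ifPn => // e; apply: starter_sym; rewrite ?h_lt //.
    by apply: contraNneq xy => /(h_inj _ _ hx hy) ->.
  by rewrite sub_mod_half_sym ?h_lt.
- by move=> x; rewrite card_multipartite_adj ME.
- move=> x y xy; case: (boolP (inner x)) => hx; case: (boolP (inner y)) => hy.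
  + rewrite /a hx hy => /add_mod_injl E.
    have {}E := h_inj _ _ hx hy (E (starter_lt KM) (h_lt _ hx) (h_lt _ hy)).
    by rewrite E /= /multipartite_adj eqxx in xy.
  + by have := a_lt _ hx; rewrite (a_outer y) //; lia.
  + by have := a_lt _ hy; rewrite (a_outer x) //; lia.
  + by rewrite (adj_inner x) in hy.
- move=> x y xy; case: (boolP (inner x)) => hx.
    have := a_lt _ hx; rewrite /c hx /c0; case: ifPn => [_|e _]; first by lia.
    rewrite /a hx => /add_mod_injr E; move/eqP: e; apply; apply/esym.
    apply: (@starter_inj K) => //; first exact: dist_lt.
    by apply: E; rewrite ?h_lt ?starter_lt ?dist_lt.
  have hy := adj_inner _ _ xy hx.
  by rewrite a_outer // /c (negbTE hx); have := c0_outer_lt _ _ hy hx; lia.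
- move=> x y z xy xz; case: (boolP (inner x)) => hx.
    rewrite /c hx => E; apply: (dist_inj x) => //; move: E.
    have dy := dist_lt _ y hx; have dz := dist_lt _ z hx.
    have lt u : dist x u < M -> add_mod M (h x) (starter K (dist x u)) < M.
      by move=> du; rewrite add_mod_lt ?h_lt ?starter_lt.
    have := lt _ dy; have := lt _ dz; rewrite /c0.
    case: eqP => [->|_]; case: eqP => [->|_] // ly lz E; try lia.
    apply: (@starter_inj K) => //.
    by apply: add_mod_injr E; rewrite ?h_lt ?starter_lt.
  have hy := adj_inner _ _ xy hx; have hz := adj_inner _ _ xz hx.
  rewrite /c (negbTE hx) !c0_outer // => /add_mod_injl E.
  by apply: h_inj => //; apply: E; rewrite ?h_lt ?starter_lt.
- move=> x; rewrite add0n /=; case: (boolP (inner x)) => hx.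
    exact/ltnW/a_lt.
  by rewrite a_outer.
Qed.

Theorem mainTheorem1 (r n : nat) (hr : 2 <= r) (hn : 1 <= n) :
  interval_total_colorable (complete_balanced_multipartite r n).
Proof.
case: (boolP (odd n)) => [on|/even_halfK en]; last first.
  by rewrite -en; apply: multipartite_even_size => //; lia.
case: (boolP (odd r)) => [/odd_halfK orr|/even_halfK er].
  have -> : r = r./2.*2.+1 by lia.
  by apply: multipartite_odd_parts => //; lia.
by rewrite -er; apply: multipartite_even_parts => //; lia.
Qed.
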